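(* A metric theory is unstable if and only if it has SOP$_2$ or the independence property.
   Context: Metric structures: a vocabulary $V$ is a countable set of constant, function and predicate symbols; a metric structure is a real-valued $V$-structure (predicates in $[0,1]$) with a distinguished binary predicate $d$ interpreted as a complete metric, all symbols uniformly continuous with prescribed moduli. Continuous formulas use continuous connectives $[0,1]^n\to[0,1]$ and quantifiers $\sup,\inf$; value $0$ means truth. A metric theory is the set of sentences with value $0$ in some metric structure. Stability: a formula $\varphi(\vec x,\vec y)$ is unstable in $T$ if there are $0\le s<r\le 1$, a model $\mathcal M\models T$ and $\langle\vec a_h,\vec b_h\rangle_{h\in\mathbb N}$ in $\mathcal M$ with $\varphi^{\mathcal M}(\vec a_h,\vec b_k)\le s$ and $\varphi^{\mathcal M}(\vec a_k,\vec b_h)\ge r$ whenever $h<k$; $T$ is stable if no formula is unstable in $T$. SOP$_2$: for $\sigma\in\{0,1\}^{\mathbb N}$, $\sigma|n$ is its restriction to $\{0,\dots,n-1\}$; $\mu,\nu\in\{0,1\}^{<\mathbb N}$ are comparable if one is an initial segment of the other. $T$ has SOP$_2$ if there is a formula $\theta(\vec x,\vec z)$ and, in some model $\mathcal M\models T$, tuples $\langle\vec b_\mu\rangle_{\mu\in\{0,1\}^{<\mathbb N}}$ such that $(\inf_{\vec x})\max\{\theta(\vec x,\vec b_{\sigma|k}):k<n\}=0$ in $\mathcal M$ for all $\sigma\in\{0,1\}^{\mathbb N}$ and $n$, and $(\inf_{\vec x})\max(\theta(\vec x,\vec b_\mu),\theta(\vec x,\vec b_\nu))=1$ in $\mathcal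 M$ for all incomparable $\mu,\nu$. Independence property: $T$ has it if there is a formula $\varphi(\vec x,\vec y)$ and a model $\mathcal M$ of $T$ such that for each $m\in\mathbb N$ there are tuples $\langle\vec a_Z\rangle_{Z\subseteq m}$ and $\langle\vec b_n\rangle_{n<m}$ (where $m=\{0,\dots,m-1\}$) with $\varphi^{\mathcal M}(\vec a_Z,\vec b_n)=0$ if $n\in Z$ and $\varphi^{\mathcal M}(\vec a_Z,\vec b_n)=1$ if $n\notin Z$. *)

(* Defs.v *)
From HB Require Import structures.
From mathcomp Require Import all_boot all_order all_algebra.
From mathcomp Require Import all_classical all_reals all_analysis.

Set Implicit Arguments.
Unset Strict Implicit.
Unset Printing Implicit Defensive.

Import Order.TTheory GRing.Theory Num.Theory.
Import numFieldNormedType.Exports.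

Local Open Scope classical_set_scope.
Local Open Scope ring_scope.

(* The distinguished predicate d is a logical symbol: it is not listed in a
   vocabulary, every formula may use it, and it is always interpreted as the
   metric of the carrier.  The moduli of uniform continuity are part of the
   vocabulary, so all structures over a vocabulary share them. *)
Record vocabulary (R : realType) := Vocabulary {
  const_sym : countType;
  fun_sym : countType;
  pred_sym : countType;
  fun_arity : fun_sym -> nat;
  pred_arity : pred_sym -> nat;
  fun_modulus : fun_sym -> R -> R;
  pred_modulus : pred_sym -> R -> R;
  fun_modulus_gt0 : forall f e, 0 < e -> 0 < fun_modulus f e;
  pred_modulus_gt0 : forall p e, 0 < e -> 0 < pred_modulus p e }.

(* Tuples carry the maximum metric, whence the condition on all coordinates in
   the two modulus fields. *)
Record metric_structure (R : realType) (V : vocabulary R) := MetricStructure {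
  carrier :> metricType R;
  carrier_nonempty : [set: carrier] !=set0;
  carrier_complete : forall F : set_system carrier,
    ProperFilter F -> cauchy F -> exists x : carrier, F --> x;
  mdist_le1 : forall x y : carrier, mdist x y <= 1;
  const_interp : const_sym V -> carrier;
  fun_interp : forall f : fun_sym V, (fun_arity f).-tuple carrier -> carrier;
  pred_interp : forall p : pred_sym V, (pred_arity p).-tuple carrier -> R;
  pred_interp_itv : forall p x, 0 <= @pred_interp p x <= 1;
  fun_interp_unif : forall f (x y : (fun_arity f).-tuple carrier) e, 0 < e ->
    (forall i, mdist (tnth x i) (tnth y i) < fun_modulus f e) ->
    mdist (fun_interp x) (fun_interp y) <= e;
  pred_interp_unif : forall p (x y : (pred_arity p).-tuple carrier) e, 0 < e ->
    (forall i, mdist (tnth x i) (tnth y i) < pred_modulus p e) ->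
    `|pred_interp x - pred_interp y| <= e }.

Definition unit_cube (R : realType) (k : nat) : set 'rV[R]_k :=
  [set v | forall i, 0 <= v ord0 i <= 1].

(* A continuous function [0,1]^k -> [0,1]; its values off the cube are junk,
   and are never used since formulas take their values in [0,1]. *)
Record connective (R : realType) (k : nat) := Connective {
  conn_fun :> 'rV[R]_k -> R;
  conn_itv : forall v, unit_cube v -> 0 <= conn_fun v <= 1;
  conn_continuous : {within @unit_cube R k, continuous conn_fun} }.

Inductive term (R : realType) (V : vocabulary R) (n : nat) : Type :=
| Var of 'I_n
| Const of const_sym V
| App (f : fun_sym V) of ('I_(fun_arity f) -> term V n).

(* [formula V n] is the type of formulas whose free variables are among the n
   variables indexed by 'I_n.  A quantifier binds the variable of index 0 of
   its body, whose variable of index i + 1 is the variable i outside. *)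
Inductive formula (R : realType) (V : vocabulary R) : nat -> Type :=
| Dist n of term V n & term V n : formula V n
| Pred n (p : pred_sym V) of ('I_(pred_arity p) -> term V n) : formula V n
| Conn n k of connective R k & ('I_k -> formula V n) : formula V n
| Sup n of formula V n.+1 : formula V n
| Inf n of formula V n.+1 : formula V n.

Notation sentence V := (formula V 0).

Fixpoint term_value (R : realType) (V : vocabulary R)
    (M : metric_structure V) (n : nat) (v : n.-tuple M) (t : term V n) : M :=
  match t with
  | Var i => tnth v i
  | Const c => const_interp M c
  | App _ ts => fun_interp [tuple term_value v (ts i) | i < _]
  end.

Fixpoint value (R : realType) (V : vocabulary R) (M : metric_structure V)
    (n : nat) (phi : formula V n) : n.-tuple M -> R :=
  match phi in formula _ n return n.-tuple M -> R with
  | Dist _ t u => fun v => mdist (term_value v t) (term_value v u)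
  | Pred _ _ ts => fun v => pred_interp [tuple term_value v (ts i) | i < _]
  | Conn _ _ c phis => fun v => c (\row_i value (phis i) v)
  | Sup _ psi => fun v => sup (range (fun a : M => value psi [tuple of a :: v]))
  | Inf _ psi => fun v => inf (range (fun a : M => value psi [tuple of a :: v]))
  end.

Definition theory (R : realType) (V : vocabulary R) (M : metric_structure V) :
    set (sentence V) :=
  [set phi | value phi [tuple of [::] : seq M] = 0].

Definition metric_theory (R : realType) (V : vocabulary R)
    (T : set (sentence V)) : Prop :=
  exists M : metric_structure V, T = theory M.

Definition models (R : realType) (V : vocabulary R) (M : metric_structure V)
    (T : set (sentence V)) : Prop :=
  T `<=` theory M.

(* The value of phi(x, y) at the tuples a for x and b for y. *)
Definition value2 (R : realType) (V : vocabulary R) (M : metric_structure V)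
    (m n : nat) (phi : formula V (m + n)) (a : m.-tuple M) (b : n.-tuple M) : R :=
  value phi [tuple of a ++ b].

Definition unstable_formula (R : realType) (V : vocabulary R)
    (T : set (sentence V)) (m n : nat) (phi : formula V (m + n)) : Prop :=
  exists s r : R, [/\ 0 <= s, s < r, r <= 1 &
  exists2 M : metric_structure V, models M T &
  exists (a : nat -> m.-tuple M) (b : nat -> n.-tuple M),
  forall h k, (h < k)%N ->
    value2 phi (a h) (b k) <= s /\ r <= value2 phi (a k) (b h)].

Definition stable (R : realType) (V : vocabulary R)
    (T : set (sentence V)) : Prop :=
  forall (m n : nat) (phi : formula V (m + n)), ~ unstable_formula T phi.

Definition comparable_words (mu nu : seq bool) : bool :=
  prefix mu nu || prefix nu mu.

(* [mkseq sigma k] is sigma|k.  The value of (inf_x) psi is written as an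
   infimum over tuples x, that is, as one infimum instead of iterated ones. *)
Definition SOP2 (R : realType) (V : vocabulary R)
    (T : set (sentence V)) : Prop :=
  exists (m l : nat) (theta : formula V (m + l)),
  exists2 M : metric_structure V, models M T &
  exists b : seq bool -> l.-tuple M,
    (forall (sigma : nat -> bool) (n : nat),
      inf (range (fun x : m.-tuple M =>
        \big[Num.max/0]_(k < n) value2 theta x (b (mkseq sigma k)))) = 0) /\
    (forall mu nu : seq bool, ~~ comparable_words mu nu ->
      inf (range (fun x : m.-tuple M =>
        Num.max (value2 theta x (b mu)) (value2 theta x (b nu)))) = 1).

Definition independence_property (R : realType) (V : vocabulary R)
    (T : set (sentence V)) : Prop :=
  exists (k l : nat) (phi : formula V (k + l)),
  exists2 M : metric_structure V, models M T &
  forall m : nat,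
  exists (a : {set 'I_m} -> k.-tuple M) (b : 'I_m -> l.-tuple M),
  forall (Z : {set 'I_m}) (n : 'I_m),
    (n \in Z -> value2 phi (a Z) (b n) = 0) /\
    (n \notin Z -> value2 phi (a Z) (b n) = 1).

(* Main.v *)
(* The converse directions are read off directly: in an SOP2 tree the nodes 0^k
   and realizations of the branches ending in 0^h 1 order each other through
   1 - theta, and the independence property yields an order in an ultrapower,
   which has the same theory by the theorem of Los.

   For the direct implication, normalize an unstable formula to a function
   g(x, k) in [0,1] and points a_h with g(a_h, k) = 0 for h < k and
   g(a_h, k) = 1 for k < h.  Fix a nonprincipal ultrafilter U on nat; it plays
   the role of an indiscernible sequence, "for generic k_1, ..., k_L" being the
   iterated quantifier "for U-many k_1, ..., for U-many k_L".  A word w in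
   {0,1} is robust within c if, however often its letters are repeated,
   for generic indices k_i there is x with |g(x, k_i) - w_i| < c.  The words
   1^i 0^j are robust within every c > 0.  If robustness within every c is
   preserved by exchanging 10 for 01, then all words are robust and the
   independence property follows.  Otherwise some p10q is robust within u while
   blocks of length K of p01q are generically not realized within v > u.
   Between the outer blocks p and q take a long generic sequence of blocks: "1
   on the block l, 0 on the block r" defines intervals, nested intervals are
   realized together because p 1^j 0^k q is, and disjoint ones exclude each
   other because p01q is not realized.  A binary tree of intervals, made
   infinite in an ultrapower, witnesses SOP2. *)

Require Import Defs.
From HB Require Import structures.
From mathcomp Require Import all_boot all_order all_algebra.
From mathcomp Require Import all_classical all_reals all_analysis.
From mathcomp Require Import lra zify.

Set Implicit Arguments.
Unset Strict Implicit.
Unset Printing Implicit Defensive.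

Import Order.TTheory GRing.Theory Num.Theory.
Import numFieldNormedType.Exports.

Local Open Scope classical_set_scope.
Local Open Scope ring_scope.

(** * Formula values lie in the unit interval *)

Section Values.
Context (R : realType) (V : vocabulary R).

Lemma mdist_itv (M : metric_structure V) (x y : M) : 0 <= mdist x y <= 1.
Proof. by rewrite mdist_ge0 mdist_le1. Qed.

Lemma sup_itv (T : Type) (F : T -> R) (a b : R) : [set: T] !=set0 ->
  (forall x, a <= F x <= b) -> a <= sup (range F) <= b.
Proof.
move=> [x0 _] Fab; have [aF Fb] := andP (Fab x0).
apply/andP; split; last first.
  apply: ge_sup; first by exists (F x0), x0.
  by move=> _ [x _ <-]; have [] := andP (Fab x).
apply: le_trans aF _; apply: ub_le_sup; last by exists x0.
by exists b => _ [x _ <-]; have [] := andP (Fab x).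
Qed.

Lemma inf_itv (T : Type) (F : T -> R) (a b : R) : [set: T] !=set0 ->
  (forall x, a <= F x <= b) -> a <= inf (range F) <= b.
Proof.
move=> [x0 _] Fab; have [aF Fb] := andP (Fab x0).
apply/andP; split.
  apply: lb_le_inf; first by exists (F x0), x0.
  by move=> _ [x _ <-]; have [] := andP (Fab x).
apply: le_trans Fb; apply: ge_inf; last by exists x0.
by exists a => _ [x _ <-]; have [] := andP (Fab x).
Qed.

Lemma value_itv (M : metric_structure V) n (phi : formula V n) (v : n.-tuple M) :
  0 <= value phi v <= 1.
Proof.
elim: phi v => {n} [n t u|n p ts|n k c phis IH|n psi IH|n psi IH] v /=.
- exact: mdist_itv.
- exact: pred_interp_itv.
- by apply: conn_itv => i; rewrite mxE.
- by apply: sup_itv => //; exact: carrier_nonempty.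
- by apply: inf_itv => //; exact: carrier_nonempty.
Qed.

End Values.

(** * Ultrapowers *)

Section Ultralimit.
Context (R : realType) (U : set_system nat) (UU : UltraFilter U).

Lemma ultrafilter_fmap (T : Type) (f : nat -> T) : UltraFilter (f @ U).
Proof.
split; first exact: fmap_proper_filter.
move=> G GF sub; apply/seteqP; split=> [A GA|]; last exact: sub.
have [//|Ac] := in_ultra_setVsetC (f @^-1` A) UU.
have GAc : G (~` A) by exact: sub.
by have /filter_ex [? []] : G (A `&` ~` A) by exact: filterI.
Qed.

Lemma ultralimit_itv (a b : R) (u : nat -> R) :
  (forall i, a <= u i <= b) -> exists2 l, u @ U --> l & a <= l <= b.
Proof.
move=> uab; have := @segment_compact R a b.
rewrite compact_ultra => /(_ (u @ U) (ultrafilter_fmap u)).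
case=> [|l [lab ul]]; last by exists l => //; rewrite /= in_itv in lab.
by apply: (@filterE _ U) => i; rewrite /= in_itv; exact: uab.
Qed.

Lemma cvg_distP (u : nat -> R) (l : R) :
  u @ U --> l <-> forall e, 0 < e -> U [set i | `|u i - l| < e].
Proof.
split=> [/cvgrPdist_lt ul e /ul|ul]; last apply/cvgrPdist_lt => e /ul;
  by apply: filterS => i /=; rewrite distrC.
Qed.

Lemma cvg_cst_on (u : nat -> R) (l : R) : U [set i | u i = l] -> u @ U --> l.
Proof.
move=> ul; apply/cvg_distP => e e0; apply: filterS ul => i /= ->.
by rewrite subrr normr0.
Qed.

End Ultralimit.

Section Ultrapower.
Context (R : realType) (V : vocabulary R) (M : metric_structure V).
Context (U : set_system nat) (UU : UltraFilter U).
Context (U_gt : forall n : nat, U [set k | (n < k)%N]).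

Implicit Types f g h : nat -> M.

Definition asymptotic f g : bool :=
  `[< (fun i => mdist (f i) (g i)) @ U --> (0 : R) >].

Lemma asymptotic_equiv : equiv_class_of asymptotic.
Proof.
split.
- move=> f; apply/asboolP; apply: cvg_cst_on.
  by apply: filterE => i; exact: mdistxx.
- move=> f g; rewrite /asymptotic; congr (`[< _ >]).
  by under eq_fun do rewrite metric_sym.
- move=> g f h /asboolP fg /asboolP gh; apply/asboolP.
  have sum0 : (fun i => mdist (f i) (g i) + mdist (g i) (h i)) @ U --> (0 : R).
    by rewrite -[0]addr0; exact: cvgD.
  apply: squeeze_cvgr (cvg_cst _) sum0; apply: filterE => i.
  by rewrite mdist_ge0 /= metric_triangle.
Qed.

Canonical asymptotic_eqrel := EquivRelPack asymptotic_equiv.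

Local Open Scope quotient_scope.

Definition ultrapower_carrier : Type := {eq_quot asymptotic_eqrel}.

HB.instance Definition _ := Choice.on ultrapower_carrier.

Local Notation N := ultrapower_carrier.

Definition uclass f : N := \pi_({eq_quot asymptotic_eqrel}) f.
Definition urepr (x : N) : nat -> M := repr (x : {eq_quot asymptotic_eqrel}).

Lemma ureprK x : uclass (urepr x) = x.
Proof. exact: reprK. Qed.

Lemma uclass_eqP f g :
  uclass f = uclass g <-> (fun i => mdist (f i) (g i)) @ U --> (0 : R).
Proof.
split=> [/eqmodP/asboolP//|H]; apply/eqmodP; exact/asboolP.
Qed.

Definition udist (x y : N) : R :=
  lim ((fun i => mdist (urepr x i) (urepr y i)) @ U).

Lemma udist_cvg (x y : N) :
  (fun i => mdist (urepr x i) (urepr y i)) @ U --> udist x y.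
Proof.
have [l ul _] := ultralimit_itv UU (fun i => mdist_itv (urepr x i) (urepr y i)).
by apply/cvg_ex; exists l.
Qed.

(** The representatives picked by [urepr] are asymptotic to [f] and [g], so triangle inequalities
    squeeze the distances between [f] and [g] between two sequences with the same limit. Hence
    [udist] can be computed from any representatives. *)
Lemma udist_uclass f g :
  (fun i => mdist (f i) (g i)) @ U --> udist (uclass f) (uclass g).
Proof.
have fE : uclass (urepr (uclass f)) = uclass f by exact: ureprK.
have gE : uclass (urepr (uclass g)) = uclass g by exact: ureprK.
move/uclass_eqP: fE => fE; move/uclass_eqP: gE => gE.
have fg := @udist_cvg (uclass f) (uclass g).
set f' := urepr _ in fE fg *; set g' := urepr _ in gE fg *.
have lo : (fun i => mdist (f' i) (g' i) - mdist (f' i) (f i) - mdist (g' i) (g i))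
    @ U --> udist (uclass f) (uclass g).
  by rewrite -[udist _ _]subr0 -[udist _ _]subr0; apply: cvgB => //; exact: cvgB.
have hi : (fun i => mdist (f' i) (g' i) + mdist (f' i) (f i) + mdist (g' i) (g i))
    @ U --> udist (uclass f) (uclass g).
  by rewrite -[udist _ _]addr0 -[udist _ _]addr0; apply: cvgD => //; exact: cvgD.
apply: squeeze_cvgr lo hi; apply: filterE => i /=.
have := metric_triangle (f' i) (f i) (g' i).
have := metric_triangle (f i) (g i) (g' i).
have := metric_triangle (f i) (f' i) (g i).
have := metric_triangle (f' i) (g' i) (g i).
rewrite (metric_sym (g i) (g' i)) (metric_sym (f i) (f' i)); lra.
Qed.

Lemma udist_itv x y : 0 <= udist x y <= 1.
Proof.
have [l ul l01] := ultralimit_itv UU (fun i => mdist_itv (urepr x i) (urepr y i)).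
by rewrite /udist (cvg_lim _ ul).
Qed.

Lemma udistxx x : udist x x = 0.
Proof.
rewrite /udist; under eq_fun do rewrite mdistxx; apply: cvg_lim => //.
exact: cvg_cst.
Qed.

Lemma udist_positivity x y : udist x y = 0 -> x = y.
Proof.
move=> xy0; rewrite -(ureprK x) -(ureprK y); apply/uclass_eqP.
by rewrite -xy0; exact: udist_cvg.
Qed.

Lemma udist_sym x y : udist x y = udist y x.
Proof. by rewrite /udist; under eq_fun do rewrite metric_sym. Qed.

Lemma udist_triangle y x z : udist x z <= udist x y + udist y z.
Proof.
apply: (ler_cvg_to (@udist_cvg x z) (cvgD (@udist_cvg x y) (@udist_cvg y z))).
by apply: filterE => i; exact: metric_triangle.
Qed.

HB.instance Definition _ := isMetric.Build R N
  udistxx udist_positivity udist_sym udist_triangle.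

Lemma udist_le f g e : U [set i | mdist (f i) (g i) <= e] ->
  udist (uclass f) (uclass g) <= e.
Proof. exact: (ler_cvg_to (@udist_uclass f g) (cvg_cst e)). Qed.

Lemma udist_lt f g e : udist (uclass f) (uclass g) < e ->
  U [set i | mdist (f i) (g i) < e].
Proof. exact: cvgr_lt (@udist_uclass f g) e. Qed.

(* Cauchy sequences of the ultrapower converge: at the index i, the limit
   follows the longest initial segment of the sequence that looks Cauchy. *)
Lemma cauchy_diagonal (h : nat -> M) (e : nat -> R) (K : nat) :
  (forall l k, (l <= k)%N -> e k <= e l) ->
  exists y, forall n, (n <= K)%N ->
    (forall l k, (l <= n)%N -> (k <= n)%N -> mdist (h l) (h k) < e l + e k) ->
    mdist y (h n) <= e n *+ 2.
Proof.
move=> e_decr; elim: K => [|K [y Hy]].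
  exists (h 0%N) => n; rewrite leqn0 => /eqP -> H; rewrite mulr2n.
  exact/ltW/H.
have [close|far] := pselect (forall l k, (l <= K.+1)%N -> (k <= K.+1)%N ->
    mdist (h l) (h k) < e l + e k).
  exists (h K.+1) => n nK _.
  apply: le_trans (ltW (close _ _ (leqnn _) nK)) _.
  by rewrite mulr2n lerD2r; exact: e_decr.
(* The longer segment does not look Cauchy, so the case [n = K.+1] is vacuous and the old [y] still
   serves. *)
exists y => n; rewrite leq_eqVlt => /orP[/eqP -> //|nK].
exact: Hy.
Qed.

Lemma ultra_forall_le (A : nat -> set nat) n :
  (forall l, U (A l)) -> U [set i | forall l, (l <= n)%N -> A l i].
Proof.
move=> UA.
have UAn : U [set i | forall l : 'I_n.+1, A l i].
  by apply: (@filter_forall nat 'I_n.+1 (fun l => A l) U _) => l; exact: UA.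
apply: filterS UAn => i Ai l ln; exact: (Ai (Ordinal (ln : (l < n.+1)%N))).
Qed.

Lemma ultrapower_complete (F : set_system N) :
  ProperFilter F -> cauchy F -> exists x : N, F --> x.
Proof.
move=> FF /cauchyP Fc.
pose e n : R := n.+1%:R^-1.
have e_gt0 n : 0 < e n by rewrite invr_gt0.
have e_decr l k : (l <= k)%N -> e k <= e l.
  by move=> lk; rewrite lef_pV2 ?posrE // ler_nat.
have [x Fx] := choice (fun n => Fc (e n) (e_gt0 n)).
pose f n := urepr (x n).
have f_close l k : U [set i | mdist (f l i) (f k i) < e l + e k].
  apply: udist_lt; rewrite !ureprK.
  have [z []] := filter_ex (filterI (Fx l) (Fx k)).
  rewrite !ballEmdist /= => xlz xkz.
  apply: le_lt_trans (@udist_triangle z _ _) _.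
  by rewrite (udist_sym z) ltrD.
(* [g i] is the diagonal point for the terms of index at most [i]. For fixed [n], [U]-many [i]
   exceed [n] and see a Cauchy-looking segment up to [n], which puts [g i] within [2 e n] of
   [f n i]. *)
have [g Hg] := @choice _ _ _ (fun i => cauchy_diagonal (f^~ i) i e_decr).
exists (uclass g).
have gx n : udist (uclass g) (x n) <= e n *+ 2.
  rewrite -(ureprK (x n)); apply: udist_le.
  have Uclose : U [set i | forall l, (l <= n)%N -> forall k, (k <= n)%N ->
      mdist (f l i) (f k i) < e l + e k].
    apply: (@ultra_forall_le (fun l => [set i | forall k, (k <= n)%N ->
      mdist (f l i) (f k i) < e l + e k])) => l.
    exact: (@ultra_forall_le (fun k => [set i |
      mdist (f l i) (f k i) < e l + e k])).
  apply: filterS2 Uclose (U_gt n) => i close ni.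
  by apply: Hg => [|l k ln kn]; [exact: ltnW | exact: close].
apply/cvg_ballP => r r0.
(* Two [e n] lead from the limit to [x n], and one more from [x n] to the points of its ball. *)
have [n nr] : exists n, e n *+ 3 < r.
  have [n nr] := ltr_add_invr (y := 0) (x := r / 3) ltac:(by rewrite divr_gt0).
  exists n; move: nr; rewrite add0r -/(e n); lra.
apply: filterS (Fx n) => y; rewrite !ballEmdist /= => xy.
apply: le_lt_trans (@udist_triangle (x n) _ _) _.
move: xy (gx n); rewrite /mdist /=; lra.
Qed.

Definition ufun (f : fun_sym V) (x : (fun_arity f).-tuple N) : N :=
  uclass (fun i => fun_interp [tuple urepr (tnth x j) i | j < _]).

Definition upred (p : pred_sym V) (x : (pred_arity p).-tuple N) : R :=
  lim ((fun i => pred_interp [tuple urepr (tnth x j) i | j < _]) @ U).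

Lemma upred_cvg (p : pred_sym V) (x : (pred_arity p).-tuple N) :
  (fun i => pred_interp [tuple urepr (tnth x j) i | j < _]) @ U --> upred x.
Proof.
have [l ul _] := ultralimit_itv UU (fun i =>
  @pred_interp_itv _ _ M p [tuple urepr (tnth x j) i | j < _]).
by apply/cvg_ex; exists l.
Qed.

Lemma upred_itv (p : pred_sym V) (x : (pred_arity p).-tuple N) :
  0 <= upred x <= 1.
Proof.
have [l ul l01] := ultralimit_itv UU (fun i =>
  @pred_interp_itv _ _ M p [tuple urepr (tnth x j) i | j < _]).
by rewrite /upred (cvg_lim _ ul).
Qed.

(** A strict bound on a limit holds at [U]-many indices, and there are finitely many coordinates. In
    this way the moduli of [M] pass to the ultrapower. *)
Lemma ultra_close k (x y : k.-tuple N) (u w : nat -> k.-tuple M) e :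
  (forall j, uclass (fun i => tnth (u i) j) = tnth x j) ->
  (forall j, uclass (fun i => tnth (w i) j) = tnth y j) ->
  (forall j, udist (tnth x j) (tnth y j) < e) ->
  U [set i | forall j, mdist (tnth (u i) j) (tnth (w i) j) < e].
Proof.
move=> ux wy xy.
apply: (@filter_forall nat 'I_k
  (fun j => [set i | mdist (tnth (u i) j) (tnth (w i) j) < e]) U _) => j.
by apply: udist_lt; rewrite ux wy.
Qed.

Lemma urepr_tuple k (x : k.-tuple N) j :
  uclass (fun i => tnth [tuple urepr (tnth x l) i | l < k] j) = tnth x j.
Proof. by under eq_fun do rewrite tnth_mktuple; exact: ureprK. Qed.

Lemma ufun_unif (s : fun_sym V) (x y : (fun_arity s).-tuple N) e : 0 < e ->
  (forall i, mdist (tnth x i) (tnth y i) < fun_modulus s e) ->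
  mdist (ufun x) (ufun y) <= e.
Proof.
move=> e0 xy; apply: udist_le.
apply: filterS (ultra_close (urepr_tuple x) (urepr_tuple y) xy) => i.
exact: fun_interp_unif.
Qed.

Lemma upred_unif p (x y : (pred_arity p).-tuple N) e : 0 < e ->
  (forall i, mdist (tnth x i) (tnth y i) < pred_modulus p e) ->
  `|upred x - upred y| <= e.
Proof.
move=> e0 xy.
have xyc : (fun i => `|pred_interp [tuple urepr (tnth x j) i | j < _] -
    pred_interp [tuple urepr (tnth y j) i | j < _]|) @ U --> `|upred x - upred y|.
  by apply: cvg_norm; apply: cvgB; exact: upred_cvg.
apply: (ler_cvg_to xyc (cvg_cst e)).
apply: filterS (ultra_close (urepr_tuple x) (urepr_tuple y) xy) => i.
exact: pred_interp_unif.
Qed.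

Lemma ultrapower_nonempty : [set: N] !=set0.
Proof. by have [a _] := carrier_nonempty M; exists (uclass (fun=> a)). Qed.

Lemma ultrapower_dist_le1 (x y : N) : mdist x y <= 1.
Proof. by have /andP[] := udist_itv x y. Qed.

Definition ultrapower : metric_structure V :=
  @MetricStructure R V N ultrapower_nonempty ultrapower_complete
    ultrapower_dist_le1 (fun c => uclass (fun=> const_interp M c))
    ufun upred upred_itv ufun_unif upred_unif.

(** Continuity of [c] is relative to the cube, so the limit [l] must first be shown to lie in the
    cube. A neighbourhood of [l] then restricts only finitely many entries. *)
Lemma connective_cvg k (c : connective R k) (w : nat -> 'rV[R]_k) (l : 'rV[R]_k) :
  (forall j i, 0 <= w j ord0 i <= 1) ->
  (forall i, (fun j => w j ord0 i) @ U --> l ord0 i) ->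
  (fun j => c (w j)) @ U --> c l.
Proof.
move=> w01 wl.
have l01 : unit_cube l.
  move=> i; have /(_ (fun j => w01 j i)) [l' wl' l'01] :=
    @ultralimit_itv R U UU 0 1 (fun j => w j ord0 i).
  by rewrite -(cvg_lim _ (wl i)) ?(cvg_lim _ wl').
have /subspace_continuousP/(_ l l01) cl := @conn_continuous _ _ c.
move=> A /cl [P lP sub]; rewrite /= /fmap /=.
have UP : U [set j | forall i, P ord0 i (w j ord0 i)].
  apply: (@filter_forall nat 'I_k (fun i => [set j | P ord0 i (w j ord0 i)]) U _).
  by move=> i; exact: (wl i _ (lP ord0 i)).
suff : U [set j | A (c (w j))] by [].
apply: filterS UP => j Pj; apply: (sub (w j) _ (w01 j)) => i i'.
by rewrite (ord1 i).
Qed.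

Lemma sup_near (T : Type) (F : T -> R) e : [set: T] !=set0 ->
  (forall x, F x <= 1) -> 0 < e -> exists x, sup (range F) - e < F x.
Proof.
move=> [x0 _] F1 e0; have [|_ [x _ <-] ?] := @sup_adherent R (range F) e e0.
  by split; [exists (F x0), x0 | exists 1 => _ [x _ <-]].
by exists x.
Qed.

Lemma inf_near (T : Type) (F : T -> R) e : [set: T] !=set0 ->
  (forall x, 0 <= F x) -> 0 < e -> exists x, F x < inf (range F) + e.
Proof.
move=> [x0 _] F0 e0; have [|_ [x _ <-] ?] := @inf_adherent R (range F) e e0.
  by split; [exists (F x0), x0 | exists 0 => _ [x _ <-]].
by exists x.
Qed.

Lemma term_los n (t : term V n) (v : n.-tuple ultrapower) (w : nat -> n.-tuple M) :
  (forall i, uclass (fun j => tnth (w j) i) = tnth v i) ->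
  uclass (fun j => term_value (w j) t) = term_value v t.
Proof.
move=> wv; elim: t => [i|c|f ts IH] //=.
apply/uclass_eqP/cvg_distP => e e0.
(* [ufun] works with the chosen representatives of the subterm values, which are only asymptotic to
   the sequences at hand. The modulus at [e / 2] bridges the two, and the half makes the bound
   strict. *)
have e2 : 0 < e / 2 by rewrite divr_gt0.
have close := @ultra_close _ _ _ (fun j => [tuple term_value (w j) (ts i) | i < _])
  (fun j => [tuple urepr (tnth [tuple term_value v (ts i) | i < _] i) j | i < _])
  (fun_modulus f (e / 2)) _ (urepr_tuple _).
apply: filterS (close [tuple term_value v (ts i) | i < _] _ _) => [j /= cl|i|i].
- rewrite subr0 ger0_norm ?mdist_ge0 //.
  by apply: le_lt_trans (fun_interp_unif e2 cl) _; lra.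
- by under eq_fun do rewrite tnth_mktuple; rewrite tnth_mktuple IH.
- by rewrite udistxx fun_modulus_gt0.
Qed.

(** Induction on [phi]. For a quantifier, each element of the ultrapower is represented by a
    sequence, whose values are bounded by the extrema in [M]; conversely, near-optimal witnesses
    chosen index by index form a single element. *)
Theorem los n (phi : formula V n) (v : n.-tuple ultrapower)
    (w : nat -> n.-tuple M) :
  (forall i, uclass (fun j => tnth (w j) i) = tnth v i) ->
  (fun j => value phi (w j)) @ U --> value phi v.
Proof.
elim: phi v w => {n} [n t u|n p ts|n k c phis IH|n psi IH|n psi IH] v w wv /=.
- rewrite -(term_los t wv) -(term_los u wv); exact: udist_uclass.
- apply/cvg_distP => e e0; have e2 : 0 < e / 2 by rewrite divr_gt0.
  have /cvg_distP/(_ _ e2) near := @upred_cvg p [tuple term_value v (ts i) | i < _].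
  have close := @ultra_close _ _ _ (fun j => [tuple term_value (w j) (ts i) | i < _])
    (fun j => [tuple urepr (tnth [tuple term_value v (ts i) | i < _] i) j | i < _])
    (pred_modulus p (e / 2)) _ (urepr_tuple _).
  apply: filterS2 near (close [tuple term_value v (ts i) | i < _] _ _)
    => [j nj /= cl|i|i].
  + apply: le_lt_trans (ler_distD (pred_interp [tuple urepr
      (tnth [tuple term_value v (ts i) | i < _] i) j | i < _]) _ _) _.
    have := pred_interp_unif e2 cl; move: nj => /=; lra.
  + by under eq_fun do rewrite tnth_mktuple; rewrite tnth_mktuple (term_los _ wv).
  + by rewrite udistxx pred_modulus_gt0.
- apply: connective_cvg => [j i|i]; first by rewrite mxE value_itv.
  by under eq_fun do rewrite mxE; rewrite mxE; exact: IH.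
- set F := fun a : ultrapower => _.
  pose G j := fun a : M => value psi [tuple of a :: w j].
  have lift_los (f : nat -> M) : (fun j => G j (f j)) @ U --> F (uclass f).
    apply: IH => i; case: (unliftP ord0 i) => [i'|] ->.
      by under eq_fun do rewrite tnthS; rewrite tnthS wv.
    by under eq_fun do rewrite tnth0; rewrite tnth0.
  have G01 j a : 0 <= G j a <= 1 by exact: value_itv.
  have [l Gl _] := ultralimit_itv UU (fun j => sup_itv (carrier_nonempty M) (G01 j)).
  suff -> : sup (range F) = l by [].
  apply/eqP; rewrite eq_le; apply/andP; split.
    apply: ge_sup; first by have [a _] := ultrapower_nonempty; exists (F a), a.
    move=> _ [a _ <-]; rewrite -(ureprK a).
    apply: (ler_cvg_to (lift_los (urepr a)) Gl); apply: filterE => j.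
    apply: ub_le_sup; last by exists (urepr a j).
    by exists 1 => _ [b _ <-]; have /andP[] := G01 j b.
  apply/ler_addgt0Pr => e e0.
  have [f Hf] := choice (fun j => sup_near (carrier_nonempty M)
    (fun a => proj2 (andP (G01 j a))) e0).
  have Fl : l - e <= F (uclass f).
    apply: (ler_cvg_to (cvgB Gl (cvg_cst e)) (lift_los f)).
    by apply: filterE => j; exact: ltW (Hf j).
  rewrite -lerBlDr; apply: le_trans Fl _; apply: ub_le_sup; last by exists (uclass f).
  exists 1 => _ [b _ <-].
  by have /andP[] := @value_itv _ _ ultrapower _ psi [tuple of b :: v].
- set F := fun a : ultrapower => _.
  pose G j := fun a : M => value psi [tuple of a :: w j].
  have lift_los (f : nat -> M) : (fun j => G j (f j)) @ U --> F (uclass f).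
    apply: IH => i; case: (unliftP ord0 i) => [i'|] ->.
      by under eq_fun do rewrite tnthS; rewrite tnthS wv.
    by under eq_fun do rewrite tnth0; rewrite tnth0.
  have G01 j a : 0 <= G j a <= 1 by exact: value_itv.
  have [l Gl _] := ultralimit_itv UU (fun j => inf_itv (carrier_nonempty M) (G01 j)).
  suff -> : inf (range F) = l by [].
  apply/eqP; rewrite eq_le; apply/andP; split; last first.
    apply: lb_le_inf; first by have [a _] := ultrapower_nonempty; exists (F a), a.
    move=> _ [a _ <-]; rewrite -(ureprK a).
    apply: (ler_cvg_to Gl (lift_los (urepr a))); apply: filterE => j.
    apply: ge_inf; last by exists (urepr a j).
    by exists 0 => _ [b _ <-]; have /andP[] := G01 j b.
  apply/ler_addgt0Pr => e e0.
  have [f Hf] := choice (fun j => inf_near (carrier_nonempty M)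
    (fun a => proj1 (andP (G01 j a))) e0).
  have Fl : F (uclass f) <= l + e.
    apply: (ler_cvg_to (lift_los f) (cvgD Gl (cvg_cst e))).
    by apply: filterE => j; exact: ltW (Hf j).
  apply: le_trans Fl; apply: ge_inf; last by exists (uclass f).
  exists 0 => _ [b _ <-].
  by have /andP[] := @value_itv _ _ ultrapower _ psi [tuple of b :: v].
Qed.

Lemma ultrapower_models (T : set (sentence V)) : models M T -> models ultrapower T.
Proof.
move=> MT phi /MT; rewrite /theory /= => phi0.
have lim0 := @los 0 phi [tuple] (fun=> [tuple]) ltac:(by case).
rewrite -(cvg_lim _ lim0) //; apply: cvg_lim => //.
by under eq_fun do rewrite phi0; exact: cvg_cst.
Qed.

End Ultrapower.

(** * Threshold formulas *)

Section Renaming.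
Context (R : realType) (V : vocabulary R).

(** Renaming produces copies of one formula that read different parameters. Under a quantifier,
    index 0 is the bound variable and must stay fixed. *)
Definition lift_renaming k n (f : 'I_k -> 'I_n) (i : 'I_k.+1) : 'I_n.+1 :=
  if unlift ord0 i is Some j then lift ord0 (f j) else ord0.

Fixpoint rename_term k n (f : 'I_k -> 'I_n) (t : term V k) : term V n :=
  match t with
  | Var i => Var V (f i)
  | Const c => Const n c
  | App _ ts => App (fun i => rename_term f (ts i))
  end.

Fixpoint rename k (phi : formula V k) : forall n, ('I_k -> 'I_n) -> formula V n :=
  match phi in formula _ k return forall n, ('I_k -> 'I_n) -> formula V n with
  | Dist _ t u => fun _ f => Dist (rename_term f t) (rename_term f u)
  | Pred _ _ ts => fun _ f => Pred (fun i => rename_term f (ts i))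
  | Conn _ _ c phis => fun _ f => Conn c (fun i => rename (phis i) f)
  | Sup _ psi => fun _ f => Sup (rename psi (lift_renaming f))
  | Inf _ psi => fun _ f => Inf (rename psi (lift_renaming f))
  end.

Context (M : metric_structure V).

Lemma rename_term_value k n (f : 'I_k -> 'I_n) (t : term V k) (v : n.-tuple M) :
  term_value v (rename_term f t) = term_value [tuple tnth v (f i) | i < k] t.
Proof.
elim: t => [i|c|g ts IH] //=; first by rewrite tnth_mktuple.
by congr fun_interp; apply: eq_from_tnth => i; rewrite !tnth_mktuple IH.
Qed.

Lemma lift_renaming_tuple k n (f : 'I_k -> 'I_n) (a : M) (v : n.-tuple M) :
  [tuple tnth [tuple of a :: v] (lift_renaming f i) | i < k.+1] =
  [tuple of a :: [tuple tnth v (f i) | i < k]].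
Proof.
apply: eq_from_tnth => i; rewrite tnth_mktuple /lift_renaming.
by case: unliftP => [j|] ->; rewrite ?tnthS ?tnth0 ?tnth_mktuple.
Qed.

Lemma rename_value k (phi : formula V k) n (f : 'I_k -> 'I_n) (v : n.-tuple M) :
  value (rename phi f) v = value phi [tuple tnth v (f i) | i < k].
Proof.
elim: phi n f v => {k} [k t u|k p ts|k l c phis IH|k psi IH|k psi IH] n f v /=.
- by rewrite !rename_term_value.
- congr pred_interp; apply: eq_from_tnth => i.
  by rewrite !tnth_mktuple rename_term_value.
- by congr conn_fun; apply/rowP => i; rewrite !mxE IH.
- by under eq_fun do rewrite IH lift_renaming_tuple.
- by under eq_fun do rewrite IH lift_renaming_tuple.
Qed.

End Renaming.

Section ContinuousExtrema.
Context (R : realType) (T : Type) (F : set_system T) {FF : Filter F}.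
Context (f g : T -> R) (a b : R) (fa : f @ F --> a) (gb : g @ F --> b).

Lemma cvg_max : (fun x => Num.max (f x) (g x)) @ F --> Num.max a b.
Proof.
rewrite maxr_absE; under eq_fun do rewrite maxr_absE.
apply: cvgM; last exact: cvg_cst.
by apply: cvgD; [exact: cvgD | apply: cvg_norm; exact: cvgB].
Qed.

Lemma cvg_min : (fun x => Num.min (f x) (g x)) @ F --> Num.min a b.
Proof.
rewrite minr_absE; under eq_fun do rewrite minr_absE.
apply: cvgM; last exact: cvg_cst.
by apply: cvgB; [exact: cvgD | apply: cvg_norm; exact: cvgB].
Qed.

End ContinuousExtrema.

Section Threshold.
Context (R : realType) (k : nat) (s : 'I_k -> bool) (u w : R).

Definition pattern_dist (v : 'rV[R]_k) : R :=
  \big[Num.max/0]_(i < k) `|v ord0 i - (s i)%:R|.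

(** For [u < w], a ramp that is 0 up to distance [u] from the pattern [s] and 1 from distance [w]
    on. It turns a gap between two accuracies into exact truth values. *)
Definition threshold_fun (v : 'rV[R]_k) : R :=
  Num.max 0 (Num.min 1 ((pattern_dist v - u) / (w - u))).

Lemma threshold_itv v : 0 <= threshold_fun v <= 1.
Proof. by rewrite /threshold_fun le_max lexx /= ge_max ler01 ge_min lexx. Qed.

Lemma pattern_dist_continuous : continuous pattern_dist.
Proof.
suff dist_continuous r : continuous (fun v : 'rV[R]_k =>
    \big[Num.max/0]_(i <- r) `|v ord0 i - (s i)%:R|) by exact: dist_continuous.
elim: r => [|i r IH] v.
  have -> : (fun v : 'rV[R]_k =>
      \big[Num.max/0]_(i <- [::]) `|v ord0 i - (s i)%:R|) = (fun=> 0).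
    by apply/funext => x; rewrite big_nil.
  exact: cst_continuous.
have -> : (fun v : 'rV[R]_k =>
    \big[Num.max/0]_(l <- i :: r) `|v ord0 l - (s l)%:R|) =
  (fun v : 'rV[R]_k => Num.max `|v ord0 i - (s i)%:R|
    (\big[Num.max/0]_(l <- r) `|v ord0 l - (s l)%:R|)).
  by apply/funext => x; rewrite big_cons.
refine (cvg_max _ (IH v)).
apply: cvg_norm; apply: cvgB; last exact: cvg_cst.
exact: coord_continuous.
Qed.

Lemma threshold_continuous : {within @unit_cube R k, continuous threshold_fun}.
Proof.
apply: continuous_subspaceT => v; rewrite /threshold_fun.
have v_filter : Filter (nbhs v) by exact: nbhs_filter.
refine (cvg_max (cvg_cst _) (cvg_min (cvg_cst _) (cvgM _ (cvg_cst _)))).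
by refine (cvgB (@pattern_dist_continuous v) (cvg_cst _)).
Qed.

Definition threshold : connective R k :=
  Connective (fun v _ => threshold_itv v) threshold_continuous.

Context (uw : u < w).

Lemma threshold_eq0 (v : 'rV[R]_k) : 0 <= u ->
  (forall i, `|v ord0 i - (s i)%:R| <= u) ->
  threshold v = 0.
Proof.
(* [0 <= u] accounts for the default value 0 of the maximum. *)
move=> u0 vu; have vs : pattern_dist v <= u by exact: bigmax_le.
rewrite /= /threshold_fun; apply/max_idPl; rewrite ge_min; apply/orP; right.
by rewrite pmulr_lle0 ?invr_gt0 ?subr_gt0 // subr_le0.
Qed.

Lemma threshold_eq1 (v : 'rV[R]_k) i : w <= `|v ord0 i - (s i)%:R| -> threshold v = 1.
Proof.
move=> wv; have vs : w <= pattern_dist v.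
  by apply: le_trans wv _; exact: (le_bigmax _ (fun i => `|v ord0 i - (s i)%:R|)).
rewrite /= /threshold_fun (min_idPl _) ?(max_idPr _) //.
by rewrite ler_pdivlMr ?subr_gt0 // mul1r lerD2r.
Qed.

Lemma threshold_lt1 (v : 'rV[R]_k) : threshold v < 1 ->
  forall i, `|v ord0 i - (s i)%:R| < w.
Proof.
by move=> v1 i; rewrite ltNge; apply/negP => /threshold_eq1 H; rewrite H ltxx in v1.
Qed.

End Threshold.

Section PatternFormula.
Context (R : realType) (V : vocabulary R) (m n : nat) (phi : formula V (m + n)).

(** The [k] parameter tuples are laid out as one tuple indexed by pairs of a block and a
    coordinate. *)
Local Notation params k := #|{: 'I_k * 'I_n}|.

Definition join_tuple (T : Type) k (c : 'I_k -> n.-tuple T) : (params k).-tuple T :=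
  [tuple tnth (c (enum_val i).1) (enum_val i).2 | i < params k].

(** The copy number [j] shares the variables [x] with all other copies and reads its parameters in
    block [j]. *)
Definition block_renaming k (j : 'I_k) (i : 'I_(m + n)) : 'I_(m + params k) :=
  match fintype.split i with
  | inl l => lshift _ l
  | inr l => rshift m (enum_rank (j, l))
  end.

Definition pattern_formula k (s : 'I_k -> bool) (u w : R) : formula V (m + params k) :=
  Conn (threshold s u w) (fun j => rename phi (block_renaming j)).

Lemma value2_pattern (M : metric_structure V) k (s : 'I_k -> bool) u w
    (a : m.-tuple M) (c : 'I_k -> n.-tuple M) :
  value2 (pattern_formula s u w) a (join_tuple c) =
  threshold s u w (\row_j value2 phi a (c j)).
Proof.
rewrite /value2 [LHS]/=; congr threshold_fun; apply/rowP => j; rewrite !mxE.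
rewrite rename_value; congr value; apply: eq_from_tnth => i.
rewrite tnth_mktuple /block_renaming; case: split_ordP => l ->.
  by rewrite !tnth_lshift.
by rewrite !tnth_rshift tnth_mktuple enum_rankK.
Qed.

End PatternFormula.

(** * Generic patterns *)

Section UltraQuantifier.
Context (U : set_system nat) (UU : UltraFilter U).
Context (U_gt : forall n : nat, U [set k | (n < k)%N]).

(** The head of the list is quantified outermost, so each index is generic over the earlier ones. *)
Fixpoint ultra_all (L : nat) (P : seq nat -> Prop) : Prop :=
  if L is L'.+1 then U [set k | ultra_all L' (fun ks => P (k :: ks))]
  else P [::].

Lemma ultra_allS L (P Q : seq nat -> Prop) :
  (forall ks, P ks -> Q ks) -> ultra_all L P -> ultra_all L Q.
Proof.
elim: L P Q => [|L IH] P Q PQ /=; first exact: PQ.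
by apply: filterS => k; apply: IH => ks; exact: PQ.
Qed.

Lemma ultra_all_true L (P : seq nat -> Prop) :
  (forall ks, P ks) -> ultra_all L P.
Proof. by elim: L P => [|L IH] P PT //=; apply: filterE => k; exact: IH. Qed.

Lemma ultra_allI L (P Q : seq nat -> Prop) :
  ultra_all L P -> ultra_all L Q -> ultra_all L (fun ks => P ks /\ Q ks).
Proof.
elim: L P Q => [|L IH] P Q //=.
by apply: filterS2 => k; exact: IH.
Qed.

(** The quantifier is self-dual, since a set or its complement belongs to [U]. *)
Lemma ultra_all_not L (P : seq nat -> Prop) :
  ~ ultra_all L P -> ultra_all L (fun ks => ~ P ks).
Proof.
elim: L P => [|L IH] P //= nP.
have [//|] := in_ultra_setVsetC [set k | ultra_all L (fun ks => P (k :: ks))] UU.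
by apply: filterS => k; exact: IH.
Qed.

Lemma ultra_all_size L : ultra_all L (fun ks => size ks = L).
Proof.
elim: L => [|L IH] //=; apply: filterE => k.
by apply: ultra_allS IH => ks /= ->.
Qed.

Lemma ultra_all_ex L (P : seq nat -> Prop) :
  ultra_all L P -> exists2 ks, size ks = L & P ks.
Proof.
elim: L P => [|L IH] P /=; first by exists [::].
by move=> /filter_ex [k /IH [ks ksL Pks]]; exists (k :: ks) => //=; rewrite ksL.
Qed.

Lemma ultra_all_seq (T : eqType) (r : seq T) L (P : T -> seq nat -> Prop) :
  (forall t, t \in r -> ultra_all L (P t)) ->
  ultra_all L (fun ks => forall t, t \in r -> P t ks).
Proof.
elim: r => [|t r IH] HP; first exact: ultra_all_true.
have [Pt Pr] := (HP t (mem_head _ _), IH (fun t' tr =>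
  HP t' (@mem_behead _ (t :: r) _ tr))).
apply: ultra_allS (ultra_allI Pt Pr) => ks [Ptks Prks] t'.
by rewrite in_cons => /orP[/eqP ->|/Prks].
Qed.

(** This replaces indiscernibility: what holds generically holds along all subsequences of a generic
    list. A subsequence either starts at the head, which is generic for the remaining indices, or
    lies in the tail. *)
Lemma ultra_all_subseq k L (P : seq nat -> Prop) : ultra_all k P ->
  ultra_all L (fun ks => forall ks', subseq ks' ks -> size ks' = k -> P ks').
Proof.
elim: L k P => [|L IH] [|k] P Pk /=.
- by move=> ks' _ /size0nil ->.
- by case=> [|b ks'].
- by apply: filterE => a; apply: ultra_all_true => ks ks' _ /size0nil ->.
have tail := IH _ _ Pk.
have {}Pk : U [set a | ultra_all k (fun ks => P (a :: ks))] := Pk.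
apply: filterS Pk => a /IH head.
apply: ultra_allS (ultra_allI tail head) => ks [Pks Paks] [|b ks'] //=.
case: ifP => [/eqP -> sub [ksk]|_ sub ksk]; first exact: Paks.
exact: Pks.
Qed.

(** The gap leaves an integer [h] strictly between consecutive indices, so that the point [a h] can
    separate them. *)
Definition gap : rel nat := fun k l => (k.+1 < l)%N.

Lemma ultra_all_gap L k : ultra_all L (path gap k).
Proof.
elim: L k => [|L IH] k //=; apply: filterS (U_gt k.+1) => l kl.
by apply: ultra_allS (IH l) => ks /= ->; rewrite andbT.
Qed.

(** The witness is one more than the last entry of [ks], or than [k] if [ks] is empty. *)
Lemma gap_separation k ks ls : path gap k (ks ++ ls) -> exists h,
  [/\ (k < h)%N, {in ks, forall i, (i < h)%N} & {in ls, forall i, (h < i)%N}].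
Proof.
elim: ks k => [|l ks IH] k /=.
  have gap_trans : transitive gap by rewrite /gap => b a c; lia.
  move=> /(order_path_min gap_trans)/allP ls_gt.
  by exists k.+1; split=> // i /ls_gt.
move=> /andP[kl /IH [h [lh ks_lt ls_gt]]]; exists h; split=> //.
  by move: kl lh; rewrite /gap; lia.
by move=> i; rewrite in_cons => /orP[/eqP ->|/ks_lt].
Qed.

End UltraQuantifier.

(** * Words and subsequences *)

Section Words.

Definition blow (K : nat) (w : seq bool) : seq bool :=
  flatten [seq nseq K b | b <- w].

Lemma blow_cat K w1 w2 : blow K (w1 ++ w2) = blow K w1 ++ blow K w2.
Proof. by rewrite /blow map_cat flatten_cat. Qed.

Lemma blow_nseq K n b : blow K (nseq n b) = nseq (K * n) b.
Proof. by elim: n => [|n IH]; rewrite ?muln0 // mulnS nseqD -IH. Qed.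

Lemma blow1 w : blow 1 w = w.
Proof. by elim: w => //= b w {2}<-. Qed.

Lemma size_blow K w : size (blow K w) = (K * size w)%N.
Proof.
by elim: w => [|b w IH]; rewrite ?muln0 //= size_cat size_nseq IH mulnS.
Qed.

Lemma subseq_nseq (b : bool) k l : (k <= l)%N -> subseq (nseq k b) (nseq l b).
Proof. by move=> kl; rewrite -(subnKC kl) nseqD prefix_subseq. Qed.

Lemma subseq_blow K L w : (K <= L)%N -> subseq (blow K w) (blow L w).
Proof.
move=> KL; elim: w => [|b w IH] //=.
by apply: cat_subseq IH; exact: subseq_nseq.
Qed.

(** Bubble sort run backwards: [shift] moves a letter 1 to the right across a block of 0s, and
    [all_words] absorbs the letters of [w] one by one into a sorted prefix. *)
Lemma swap_induction (P : seq bool -> Prop) :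
  (forall i j, P (nseq i true ++ nseq j false)) ->
  (forall p q, P (p ++ true :: false :: q) -> P (p ++ false :: true :: q)) ->
  forall w, P w.
Proof.
move=> sortedP swapP.
have shift j p q : P (p ++ true :: nseq j false ++ q) ->
    P (p ++ nseq j false ++ true :: q).
  elim: j p => [|j IH] p //= /swapP; rewrite -cat_rcons => /IH.
  by rewrite cat_rcons.
suff all_words w i j : P (nseq i true ++ nseq j false ++ w).
  by move=> w; exact: (all_words w 0%N 0%N).
elim: w i j => [|[] w IH] i j; first by rewrite cats0.
  by apply: shift; have := IH i.+1 j; rewrite -addn1 nseqD -catA.
by have := IH i j.+1; rewrite -[j.+1]addn1 nseqD -catA.
Qed.

Lemma subseq_nth2 (T : eqType) (x0 : T) (s : seq T) l r :
  (l < r < size s)%N -> subseq [:: nth x0 s l; nth x0 s r] s.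
Proof.
elim: s l r => [|x s IH] [|l] [|r] //=; rewrite ?ltnS ?ltn0 ?andbF //.
  by move=> rs; rewrite eqxx sub1seq mem_nth.
move=> lr; have /= H := IH _ _ lr.
by case: ifP => // _; apply: subseq_trans (subseq_cons _ _) H.
Qed.

Lemma subseq_flatten (ss ts : seq (seq nat)) :
  subseq ss ts -> subseq (flatten ss) (flatten ts).
Proof.
elim: ts ss => [|t ts IH] [|s ss] //=; first by rewrite sub0seq.
case: eqP => [-> /IH|_ /IH /= sub]; first by apply: cat_subseq.
by apply: subseq_trans sub _; exact: suffix_subseq.
Qed.

End Words.

(** * Generic and robust words *)

Section Patterns.
Context (R : realType) (X : Type) (g : X -> nat -> R).
Context (U : set_system nat) (UU : UltraFilter U).
Context (U_gt : forall n : nat, U [set k | (n < k)%N]).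

Implicit Types (x : X) (ks : seq nat) (w : seq bool) (c : R).

Definition realizes x (ps : seq (nat * bool)) c : Prop :=
  forall p, p \in ps -> `|g x p.1 - p.2%:R| < c.

Definition realizes_blocks x (ps : seq (seq nat * bool)) c : Prop :=
  forall p k, p \in ps -> k \in p.1 -> `|g x k - p.2%:R| < c.

(** All blocks having the size [K] keeps the flattened indices aligned with the repeated letters. *)
Lemma realizes_flatten x (bls : seq (seq nat)) w K c :
  {in bls, forall bl, size bl = K} ->
  realizes x (zip (flatten bls) (blow K w)) c <->
  realizes_blocks x (zip bls w) c.
Proof.
elim: bls w => [|bl bls IH] [|b w] sizeK /=.
- by split.
- by case: (blow K (b :: w)) => [|? ?]; split.
- by case: (bl ++ _) => [|? ?]; split.
have blK : size bl = K by apply: sizeK; rewrite mem_head.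
have {}IH := IH w (fun bl' Hbl' => sizeK bl' (@mem_behead _ (bl :: bls) _ Hbl')).
rewrite zip_cat ?size_nseq //.
have zip_bl : forall k, k \in bl -> (k, b) \in zip bl (nseq K b).
  by rewrite -blK; elim: bl {sizeK blK} => //= k bl IHbl l; rewrite !in_cons
    => /orP[/eqP ->|/IHbl ->]; rewrite ?eqxx ?orbT.
have zip_blV : forall p, p \in zip bl (nseq K b) -> p.1 \in bl /\ p.2 = b.
  rewrite -blK; elim: bl {sizeK blK zip_bl} => //= k bl IHbl p.
  by rewrite !in_cons => /orP[/eqP -> /=|/IHbl[-> ->]]; rewrite ?eqxx ?orbT.
split=> H p.
  move=> k; rewrite in_cons => /orP[/eqP -> /= kbl|pz].
    by apply: (H (k, b)); rewrite mem_cat zip_bl.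
  by move: p k pz; apply/IH => p pz; apply: H; rewrite mem_cat pz orbT.
rewrite mem_cat => /orP[/zip_blV[pbl ->]|pz].
  by apply: (H (bl, b)) => //; rewrite mem_head.
by move: p pz; apply/IH => p k pz; apply: H; rewrite in_cons pz orbT.
Qed.

Definition realizable ks w c := exists x, realizes x (zip ks w) c.

Definition generic w c : Prop :=
  ultra_all U (size w) (fun ks => realizable ks w c).

Lemma zip_mask (S T : Type) (m : bitseq) (s : seq S) (t : seq T) :
  size s = size t -> zip (mask m s) (mask m t) = mask m (zip s t).
Proof.
elim: m s t => [|b m IH] [|i s] [|j t] //= [st]; case: b => //=; rewrite IH //.
Qed.

Lemma realizable_subseq ks w w' c : size ks = size w -> subseq w' w ->
  realizable ks w c ->
  exists ks', [/\ subseq ks' ks, size ks' = size w' & realizable ks' w' c].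
Proof.
move=> ksw /subseqP[m mw ->] [x xr]; exists (mask m ks); split.
- exact: mask_subseq.
- by rewrite !size_mask // mw ksw.
by exists x; rewrite zip_mask // => p /mem_mask /xr.
Qed.

(** Otherwise [w'] would fail at all subsequences of the right size of a generic list, including the
    indices that carry [w'] inside a realization of [w]. *)
Lemma generic_subseq w w' c : subseq w' w -> generic w c -> generic w' c.
Proof.
move=> sub gw; apply: contrapT => /(ultra_all_not UU).
move=> /(ultra_all_subseq UU (size w)) bad.
have := ultra_allI UU (ultra_allI UU gw (ultra_all_size UU (size w))) bad.
move=> /(ultra_all_ex UU)[ks _ [[rks ksw] {}bad]].
have [ks' [sub' size' real']] := realizable_subseq ksw sub rks.
exact: bad sub' size' real'.
Qed.

Lemma mem_zip (S T : eqType) (s : seq S) (t : seq T) p :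
  p \in zip s t -> p.1 \in s /\ p.2 \in t.
Proof.
elim: s t => [|i s IH] [|j t] //=; rewrite !in_cons.
by move=> /orP[/eqP ->|/IH[-> ->]]; rewrite ?eqxx ?orbT.
Qed.

Definition robust w c : Prop := forall K, generic (blow K w) c.

Context (a : nat -> X).
Context (g_lt : forall h k, (h < k)%N -> g (a h) k = 0).
Context (g_gt : forall h k, (k < h)%N -> g (a h) k = 1).

Lemma generic_sorted i j c : 0 < c -> generic (nseq i true ++ nseq j false) c.
Proof.
move=> c0; rewrite /generic size_cat !size_nseq.
have gaps := ultra_allI UU (ultra_all_gap UU U_gt (i + j) 0)
  (ultra_all_size UU (i + j)).
apply: ultra_allS gaps => ks [ks_gap ks_size].
have takei : size (take i ks) = i by rewrite size_takel // ks_size leq_addr.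
move: ks_gap; rewrite -{1}(cat_take_drop i ks) => /gap_separation[h [_ lth gth]].
(* The index [h] lies above the indices labelled 1 and below those labelled 0. *)
exists (a h); rewrite -(cat_take_drop i ks) zip_cat ?size_nseq // => p.
rewrite mem_cat => /orP[] /mem_zip[]; rewrite mem_nseq.
  by move=> /lth /g_gt -> /andP[_ /eqP ->]; rewrite subrr normr0.
by move=> /gth /g_lt -> /andP[_ /eqP ->]; rewrite subrr normr0.
Qed.

(** If no exchange of 10 for 01 destroys robustness, [swap_induction] spreads it from the sorted
    words to all words. *)
Lemma robust_dichotomy : (forall w c, 0 < c -> robust w c) \/
  exists p q u v, [/\ 0 < u, u < v, robust (p ++ true :: false :: q) u &
    ~ robust (p ++ false :: true :: q) v].
Proof.
have [|nswap] := pselect (exists p q u v, [/\ 0 < u, u < v,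
  robust (p ++ true :: false :: q) u & ~ robust (p ++ false :: true :: q) v]).
  by right.
left; apply: swap_induction => [i j c c0 K|p q H c c0].
  by rewrite blow_cat !blow_nseq; exact: generic_sorted.
(* [p10q] is robust within every accuracy, in particular [c / 2], which leaves the room [u < v] for
   a threshold. *)
apply: contrapT => nrob; apply: nswap; exists p, q, (c / 2), c; split=> //.
- by rewrite divr_gt0.
- lra.
- by apply: H; rewrite divr_gt0.
Qed.

(** There are finitely many words of length [n], so one generic list serves them all. *)
Lemma shattered n c : (forall w, generic w c) ->
  exists2 ks, size ks = n & forall w, size w = n -> realizable ks w c.
Proof.
move=> gen.
have all_w : ultra_all U n (fun ks =>
    forall w : n.-tuple bool, w \in enum {: n.-tuple bool} -> realizable ks w c).
  apply: ultra_all_seq => w _.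
  by have := gen w; rewrite /generic size_tuple.
have [ks ksn real] := ultra_all_ex UU all_w; exists ks => // w /eqP wn.
by apply: (real (Tuple wn)); rewrite mem_enum.
Qed.

End Patterns.

(** * Dyadic intervals indexed by binary words *)

Section Intervals.

(** Number the leaves of the binary tree of height [D] from 0 to [2 ^ D - 1]. Those below the node
    [mu] run from [left_end D mu] to [right_end D mu] inclusive. *)
Fixpoint left_end (D : nat) (mu : seq bool) : nat :=
  if mu is b :: mu' then (b * 2 ^ D.-1 + left_end D.-1 mu')%N else 0%N.

Definition right_end (D : nat) (mu : seq bool) : nat :=
  (left_end D mu + (2 ^ (D - size mu)).-1)%N.

Lemma left_end_le D mu : (size mu <= D)%N ->
  (left_end D mu + 2 ^ (D - size mu) <= 2 ^ D)%N.
Proof.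
elim: mu D => [|b mu IH] [|D] //=; rewrite ltnS => /IH H.
rewrite subSS expnS; case: b; lia.
Qed.

Lemma right_end_lt D mu : (size mu <= D)%N -> (right_end D mu < 2 ^ D)%N.
Proof.
move=> muD; have := left_end_le muD; rewrite /right_end.
have := expn_gt0 2 (D - size mu); lia.
Qed.

(** At least two leaves lie below a node that is not itself a leaf. *)
Lemma left_end_lt D mu : (size mu < D)%N -> (left_end D mu < right_end D mu)%N.
Proof.
move=> muD; rewrite /right_end.
have : (2 ^ 1 <= 2 ^ (D - size mu))%N by rewrite leq_exp2l // subn_gt0.
lia.
Qed.

Lemma interval_prefix D mu nu : (size mu <= D)%N -> prefix nu mu ->
  (left_end D nu <= left_end D mu)%N && (right_end D mu <= right_end D nu)%N.
Proof.
rewrite /right_end; elim: nu mu D => [|b nu IH] mu D muD.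
  have := left_end_le muD; have := expn_gt0 2 (D - size mu).
  by move=> /= ? ? _; rewrite subn0; lia.
case: mu D muD => [|b' mu] [|D] //= muD /andP[/eqP <- /(IH mu D muD)].
by rewrite !subSS; lia.
Qed.

Lemma interval_incomparable D mu nu : (size mu <= D)%N -> (size nu <= D)%N ->
  ~~ comparable_words mu nu ->
  (right_end D mu < left_end D nu)%N || (right_end D nu < left_end D mu)%N.
Proof.
rewrite /comparable_words; elim: mu nu D => [|b mu IH] [|b' nu] [|D] //= muD nuD.
have := right_end_lt (muD : (size mu <= D)%N).
have := right_end_lt (nuD : (size nu <= D)%N).
rewrite /right_end /= !subSS; case: eqP => [<-|].
  by rewrite eqxx /= => _ _ /(IH _ D muD nuD); rewrite /right_end; lia.
(* Different first letters put the intervals into opposite halves. *)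
by move: b b' => [] [] //= _; lia.
Qed.

End Intervals.

(** * A tree of patterns from a failed exchange *)

Section PatternTree.
Context (R : realType) (X : Type) (g : X -> nat -> R).
Context (U : set_system nat) (UU : UltraFilter U).
Context (p q : seq bool) (u v : R) (K : nat).
Context (robust_pq : robust g U (p ++ true :: false :: q) u).
Context (not_generic_pq : ~ generic g U (blow K (p ++ false :: true :: q)) v).

(** With [K * B.+1] repetitions of each letter, [p10q] contains the [K]-fold repetition of every
    step word as a subword. *)
Lemma step_generic B j : (j <= B)%N ->
  generic g U (blow K (p ++ nseq j true ++ nseq (B - j) false ++ q)) u.
Proof.
move=> jB; apply: (generic_subseq UU _ (robust_pq (K * B.+1))).
have KL : (K <= K * B.+1)%N by rewrite mulnS leq_addr.
rewrite -[true :: false :: q]/(nseq 1 true ++ nseq 1 false ++ q).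
rewrite !blow_cat !blow_nseq muln1.
apply: cat_subseq; first exact: subseq_blow.
apply: cat_subseq; first by apply: subseq_nseq; rewrite leq_mul2l; lia.
apply: cat_subseq; last exact: subseq_blow.
by apply: subseq_nseq; rewrite leq_mul2l; lia.
Qed.

Local Notation bad_size := (size (blow K (p ++ false :: true :: q))).

(** The finitely many step words are generic together, and the failure of the repeated [p01q]
    spreads to all subsequences of a generic list. A list with both properties is cut into blocks of
    size [K]. *)
Lemma block_sequence B : exists bls : seq (seq nat),
  [/\ size bls = (size p + B + size q)%N, {in bls, forall bl, size bl = K},
    forall j, (j <= B)%N -> exists x, realizes_blocks g x
      (zip bls (p ++ nseq j true ++ nseq (B - j) false ++ q)) u &
    forall ks, subseq ks (flatten bls) -> size ks = bad_size ->
      ~ realizable g ks (blow K (p ++ false :: true :: q)) v].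
Proof.
set L := (K * (size p + B + size q))%N.
have good : ultra_all U L (fun ks => forall j, j \in iota 0 B.+1 ->
    realizable g ks (blow K (p ++ nseq j true ++ nseq (B - j) false ++ q)) u).
  apply: (ultra_all_seq UU) => j; rewrite mem_iota add0n ltnS => /= jB.
  have := step_generic jB; rewrite /generic size_blow !size_cat !size_nseq.
  by rewrite (_ : (K * _)%N = L) // /L; congr muln; lia.
have bad := ultra_all_subseq UU L (ultra_all_not UU not_generic_pq).
have := ultra_allI UU good bad.
move=> /(ultra_all_ex UU)[ks ksL [{}good {}bad]].
pose sh := nseq (size p + B + size q)%N K.
have sumn_sh : sumn sh = size ks by rewrite sumn_nseq ksL.
have flatE : flatten (reshape sh ks) = ks by rewrite reshapeKr // sumn_sh.
have sizeK : {in reshape sh ks, forall bl, size bl = K}.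
  move=> bl bl_in; have : size bl \in shape (reshape sh ks) by exact: map_f.
  by rewrite reshapeKl ?sumn_sh // mem_nseq => /andP[_ /eqP].
exists (reshape sh ks); split=> //; rewrite ?flatE //.
  by rewrite size_reshape size_nseq.
move=> j jB; have [|x xr] := good j; first by rewrite mem_iota add0n ltnS.
by exists x; apply/(realizes_flatten _ _ _ _ sizeK); rewrite flatE.
Qed.

Lemma zip3 (S T : Type) (s1 s2 s3 : seq S) (t1 t2 t3 : seq T) :
  size s1 = size t1 -> size s2 = size t2 ->
  zip (s1 ++ s2 ++ s3) (t1 ++ t2 ++ t3) = zip s1 t1 ++ zip s2 t2 ++ zip s3 t3.
Proof. by move=> e1 e2; rewrite !zip_cat. Qed.

Lemma mem_zip_nth (S T : eqType) (x0 : S) (y0 : T) (s : seq S) (t : seq T) i :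
  (i < size s)%N -> size s = size t -> (nth x0 s i, nth y0 t i) \in zip s t.
Proof.
move=> i_s st; rewrite -nth_zip //; apply: mem_nth.
by rewrite size_zip -st minnn.
Qed.

Lemma size_flatten_blocks (bls : seq (seq nat)) :
  {in bls, forall bl, size bl = K} -> size (flatten bls) = (K * size bls)%N.
Proof.
elim: bls => [|bl bls IH] sizeK /=; first by rewrite muln0.
rewrite size_cat IH ?mulnS ?sizeK ?mem_head // => bl' bl'_in.
by apply: sizeK; rewrite in_cons bl'_in orbT.
Qed.

(** The node [mu] asks for the word [p10q] on the outer blocks and the two middle blocks at the ends
    of its dyadic interval. *)
Lemma pattern_tree D : exists z : seq bool -> seq nat,
  let W := blow K (p ++ true :: false :: q) in
  [/\ forall mu, (size mu < D)%N -> size (z mu) = size W,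
    forall mu, (size mu < D)%N -> exists x, forall nu, prefix nu mu ->
      realizes g x (zip (z nu) W) u &
    forall mu nu, (size mu < D)%N -> (size nu < D)%N ->
      ~~ comparable_words mu nu -> forall x,
      realizes g x (zip (z mu) W) v -> realizes g x (zip (z nu) W) v -> False].
Proof.
set B := (2 ^ D)%N.
have [bls [size_bls sizeK good bad]] := block_sequence B.
pose P := take (size p) bls; pose mid := take B (drop (size p) bls).
pose Q := drop B (drop (size p) bls).
have blsE : bls = P ++ mid ++ Q by rewrite !cat_take_drop.
have sizeP : size P = size p by rewrite size_takel // size_bls; lia.
have size_mid : size mid = B by rewrite size_takel // size_drop size_bls; lia.
have sizeQ : size Q = size q by rewrite !size_drop size_bls; lia.
pose blocks l r := P ++ [:: nth [::] mid l; nth [::] mid r] ++ Q.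
have blocks_sub l r : (l < r < B)%N -> subseq (blocks l r) bls.
  move=> lr; rewrite blsE; apply: cat_subseq => //; apply: cat_subseq => //.
  by apply: subseq_nth2; rewrite size_mid.
have blocksK l r : (l < r < B)%N -> {in blocks l r, forall bl, size bl = K}.
  by move=> /blocks_sub/mem_subseq sub bl /sub; exact: sizeK.
have flat_size l r : (l < r < B)%N ->
    size (flatten (blocks l r)) = (K * (size p + 2 + size q))%N.
  move=> lr; rewrite (size_flatten_blocks (blocksK _ _ lr)) !size_cat /= sizeP sizeQ.
  by congr muln; lia.
have zipE l r b b' : zip (blocks l r) (p ++ [:: b; b'] ++ q) =
    zip P p ++ [:: (nth [::] mid l, b); (nth [::] mid r, b')] ++ zip Q q.
  by rewrite zip3.
have ends mu : (size mu < D)%N -> (left_end D mu < right_end D mu < B)%N.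
  by move=> muD; rewrite left_end_lt // right_end_lt // ltnW.
exists (fun mu => flatten (blocks (left_end D mu) (right_end D mu))) => W.
split=> [mu muD|mu muD|mu nu muD nuD].
- rewrite flat_size ?ends // size_blow !size_cat /=; congr muln; lia.
- have /andP[lr rB] := ends _ muD.
  (* This step word is 1 exactly on the middle blocks up to [left_end D mu]. The interval of a
     prefix [nu] contains that of [mu], so its left end gets 1 and its right end 0. *)
  have [|x xr] := good (left_end D mu).+1; first by lia.
  exists x => nu nu_mu.
  have nuD : (size nu < D)%N by apply: leq_ltn_trans (size_prefix nu_mu) muD.
  have /andP[ll rr] := interval_prefix (ltnW muD) nu_mu.
  have /andP[lr' rB'] := ends _ nuD.
  apply/(realizes_flatten _ _ _ _ (blocksK _ _ (ends _ nuD))).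
  rewrite -[true :: false :: q]/([:: true; false] ++ q) zipE => pr k.
  move: xr; rewrite blsE (catA (nseq _ _)) zip3 //; last first.
    by rewrite size_cat !size_nseq size_mid; lia.
  set w := nseq _ true ++ _ => xr.
  have size_w : size mid = size w by rewrite size_cat !size_nseq size_mid; lia.
  have nth_w i : (i < B)%N -> nth false w i = (i <= left_end D mu)%N.
    move=> iB; rewrite nth_cat !nth_nseq size_nseq ltnS.
    by case: (i <= left_end D mu)%N => //; case: ifP.
  have mem_w i : (i < B)%N -> (nth [::] mid i, (i <= left_end D mu)%N) \in zip mid w.
    by move=> iB; rewrite -nth_w //; apply: mem_zip_nth => //; rewrite size_mid.
  rewrite !mem_cat !in_cons in_nil orbF => prz; apply: xr; rewrite !mem_cat.
  move: prz => /orP[->//|/orP[/orP[] /eqP ->|->]]; rewrite ?orbT //.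
    by have := mem_w _ (ltn_trans lr' rB'); rewrite ll => ->; rewrite orbT.
  have := mem_w _ rB'; rewrite leqNgt (leq_trans lr rr) /= => ->.
  by rewrite orbT.
move=> inc x.
(* The right end of the earlier interval carries 0 and the left end of the later one carries 1.
   Together with the outer blocks they would realize [p01q]. *)
have clash mu' nu' : (size mu' < D)%N -> (size nu' < D)%N ->
    (right_end D mu' < left_end D nu')%N ->
    realizes g x (zip (flatten (blocks (left_end D mu') (right_end D mu'))) W) v ->
    realizes g x (zip (flatten (blocks (left_end D nu') (right_end D nu'))) W) v ->
    False.
  move=> muD' nuD' lt_ends.
  have /andP[lr1 rB1] := ends _ muD'; have /andP[lr2 rB2] := ends _ nuD'.
  move=> /(realizes_flatten _ _ _ _ (blocksK _ _ (ends _ muD'))) xmu.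
  move=> /(realizes_flatten _ _ _ _ (blocksK _ _ (ends _ nuD'))) xnu.
  have lrB : (right_end D mu' < left_end D nu' < B)%N by lia.
  apply: (bad (flatten (blocks (right_end D mu') (left_end D nu')))).
  - exact/subseq_flatten/blocks_sub.
  - by rewrite flat_size // size_blow !size_cat /=; congr muln; lia.
  exists x; apply/(realizes_flatten _ _ _ _ (blocksK _ _ lrB)).
  move: xmu xnu; rewrite -[true :: false :: q]/([:: true; false] ++ q).
  rewrite -[false :: true :: q]/([:: false; true] ++ q) !zipE => xmu xnu pr k.
  rewrite !mem_cat !in_cons in_nil orbF => /orP[prz|/orP[/orP[] /eqP ->|prz]].
  - by apply: xmu; rewrite mem_cat prz.
  - by apply: xmu; rewrite !mem_cat !in_cons eqxx !orbT.
  - by apply: xnu; rewrite !mem_cat !in_cons eqxx !orbT.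
  - by apply: xmu; rewrite !mem_cat prz !orbT.
have := interval_incomparable (ltnW muD) (ltnW nuD) inc.
by move=> /orP[] lt_ends xmu xnu; [exact: clash xmu xnu | exact: clash xnu xmu].
Qed.

End PatternTree.

(** * Instability *)

Section LiftedSequences.
Context (R : realType) (V : vocabulary R) (M : metric_structure V).
Context (U : set_system nat) (UU : UltraFilter U).
Context (U_gt : forall n : nat, U [set k | (n < k)%N]).

Local Notation N := (ultrapower M UU U_gt).

Definition class_tuple k (x : nat -> k.-tuple M) : k.-tuple N :=
  [tuple uclass UU (fun i => tnth (x i) j) | j < k].

Lemma class_tupleK k (x : k.-tuple N) : exists xs, x = class_tuple xs.
Proof.
exists (fun i => [tuple urepr (tnth x j) i | j < k]).
by apply: eq_from_tnth => j; rewrite tnth_mktuple urepr_tuple.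
Qed.

Lemma value2_los m n (phi : formula V (m + n)) (x : nat -> m.-tuple M)
    (y : nat -> n.-tuple M) :
  (fun i => value2 phi (x i) (y i)) @ U --> value2 phi (class_tuple x) (class_tuple y).
Proof.
apply: los => i; case: (split_ordP i) => j ->.
  by under eq_fun do rewrite tnth_lshift; rewrite tnth_lshift tnth_mktuple.
by under eq_fun do rewrite tnth_rshift; rewrite tnth_rshift tnth_mktuple.
Qed.

Lemma value2_los_eq m n (phi : formula V (m + n)) (x : nat -> m.-tuple M)
    (y : nat -> n.-tuple M) l : U [set i | value2 phi (x i) (y i) = l] ->
  value2 phi (class_tuple x) (class_tuple y) = l.
Proof.
move=> /(cvg_cst_on UU) lim_l.
by rewrite -(cvg_lim _ lim_l) // (cvg_lim _ (@value2_los _ _ phi x y)).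
Qed.

End LiftedSequences.

Lemma nonprincipal_ultrafilter : exists U : set_system nat,
  UltraFilter U /\ forall n : nat, U [set k | (n < k)%N].
Proof.
have [U [UU sub]] := @ultraFilterLemma nat \oo _.
by exists U; split=> // n; apply: sub; exact: nbhs_infty_gt.
Qed.

Section SingleThreshold.
Context (R : realType) (V : vocabulary R) (m n : nat) (phi : formula V (m + n)).

(** A pattern of length 1. For [b = false] the ramp is applied to [phi], for [b = true] to
    [1 - phi]. *)
Definition rescale (b : bool) (u w : R) : formula V (m + n) :=
  Conn (threshold (fun _ : 'I_1 => b) u w) (fun=> phi).

Context (M : metric_structure V) (b : bool) (u w : R).
Context (x : m.-tuple M) (y : n.-tuple M).

Lemma rescale_eq0 : 0 <= u -> u < w -> `|value2 phi x y - b%:R| <= u ->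
  value2 (rescale b u w) x y = 0.
Proof. by move=> u0 uw near; apply: threshold_eq0 => // i; rewrite mxE. Qed.

Lemma rescale_eq1 : u < w -> w <= `|value2 phi x y - b%:R| ->
  value2 (rescale b u w) x y = 1.
Proof. by move=> uw far; apply: (threshold_eq1 uw (i := ord0)); rewrite mxE. Qed.

End SingleThreshold.

(** * Instability from either property *)

Section Directions.
Context (R : realType) (V : vocabulary R) (T : set (sentence V)).

Lemma inf_eq (X : Type) (F : X -> R) c x0 :
  (forall x, c <= F x) -> F x0 = c -> inf (range F) = c.
Proof.
move=> cF Fx0; apply/eqP; rewrite eq_le; apply/andP; split.
  by rewrite -[leRHS]Fx0; apply: ge_inf; [exists c => _ [x _ <-] | exists x0].
by apply: lb_le_inf; [exists (F x0), x0 | move=> _ [x _ <-]].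
Qed.

Lemma independence_unstable : independence_property T -> ~ stable T.
Proof.
move=> [k [l [phi [M MT shat]]]] st.
have [U [UU U_gt]] := nonprincipal_ultrafilter.
have [a0 _] := carrier_nonempty M.
have order D : exists ab : (nat -> k.-tuple M) * (nat -> l.-tuple M),
    forall h n, (n < D)%N ->
      value2 phi (ab.1 h) (ab.2 n) = if (h < n)%N then 0 else 1.
  have [a [b Hab]] := shat D.
  (* The final segments above [h] give an order of length [D]; beyond [D] the parameters are a dummy
     tuple, as only [D > n] matters in the ultrapower. *)
  exists (fun h => a [set i : 'I_D | (h < i)%N]%SET,
    fun h => if insub h is Some i then b i else [tuple a0 | _ < l]) => h n nD /=.
  rewrite insubT /=; case: (Hab [set i : 'I_D | (h < i)%N]%SET (Ordinal nD)).
  by rewrite inE /=; case: ifP => hn; [move=> in0 _; exact: in0 | move=> _; exact].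
have [ab Hab] := choice order.
pose a h D := (ab D).1 h; pose b h D := (ab D).2 h.
apply: (st k l phi); exists 0, 1; split=> //.
exists (ultrapower M UU U_gt); first exact: ultrapower_models.
exists (fun h => class_tuple UU U_gt (a h)), (fun h => class_tuple UU U_gt (b h)).
move=> h n hn; split.
  rewrite (_ : value2 _ _ _ = 0) //; apply: value2_los_eq.
  by apply: filterS (U_gt n) => D /= nD; rewrite Hab ?hn.
rewrite (_ : value2 _ _ _ = 1) //; apply: value2_los_eq.
by apply: filterS (U_gt h) => D /= nD; rewrite Hab // ltnNge (ltnW hn).
Qed.

Lemma incomparable_comb h n : (h < n)%N ->
  ~~ comparable_words (rcons (nseq h false) true) (nseq n false).
Proof.
move=> hn; rewrite negb_or; apply/andP; split; apply/negP => /prefixP[s E].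
  have : true \in nseq n false by rewrite E mem_cat mem_rcons mem_head.
  by rewrite mem_nseq andbF.
have := congr1 (fun s => nth false s h) E.
by rewrite nth_rcons size_nseq ltnn eqxx nth_cat size_nseq hn nth_nseq hn.
Qed.

(** [eq_op^~ h] is the branch that is 1 at [h] and 0 elsewhere. *)
Lemma mkseq_comb h k : (k <= h.+1)%N ->
  mkseq (eq_op^~ h) k = if k == h.+1 then rcons (nseq h false) true else nseq k false.
Proof.
move=> kh; apply: (@eq_from_nth _ false) => [|i]; rewrite size_mkseq.
  by case: eqP => [->|_]; rewrite ?size_rcons size_nseq.
move=> ik; rewrite nth_mkseq //; case: (k =P h.+1) => [kE|/eqP kh'].
  rewrite nth_rcons size_nseq nth_nseq.
  by case: ltngtP => // ih; move: ik; rewrite kE ltnS leqNgt ih.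
rewrite nth_nseq ik; apply/negbTE; lia.
Qed.

Lemma SOP2_unstable : SOP2 T -> ~ stable T.
Proof.
move=> [m [l [theta [M MT [b [path_inf inc_inf]]]]]] st.
have [a0 _] := carrier_nonempty M.
have tuples_ne : [set: m.-tuple M] !=set0 by exists [tuple a0 | _ < m].
(* The infimum 0 need not be attained, so the branch through the node 0^h 1 is realized only up to
   1/2. *)
have node h : exists x : m.-tuple M, forall k, (k <= h.+1)%N ->
    value2 theta x (b (mkseq (eq_op^~ h) k)) < 2^-1.
  have half0 : 0 < 2^-1 :> R by rewrite invr_gt0.
  have max_ge0 (x : m.-tuple M) : 0 <= \big[Num.max/0]_(k < h.+2)
      value2 theta x (b (mkseq (eq_op^~ h) k)).
    by apply: bigmax_ge_id.
  have [x] := inf_near tuples_ne max_ge0 half0.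
  rewrite path_inf add0r => small; exists x => k kh.
  apply: le_lt_trans small.
  exact: (le_bigmax _ (fun k : 'I_h.+2 => value2 theta x (b (mkseq (eq_op^~ h) k)))
    (Ordinal (kh : (k < h.+2)%N))).
have [a Ha] := choice node.
have near h k : (k <= h)%N -> value2 theta (a h) (b (nseq k false)) < 2^-1.
  move=> kh; have := Ha h k (leqW kh).
  by rewrite mkseq_comb ?leqW // ltn_eqF.
(* At the node 0^h 1, incomparable with 0^k, [a h] gives a value below 1/2. A value below 1 at 0^k
   would push the infimum of the maximum below 1. *)
have far h k : (h < k)%N -> value2 theta (a h) (b (nseq k false)) = 1.
  move=> hk; have := Ha h h.+1 (leqnn _); rewrite mkseq_comb // eqxx => small.
  have /andP[ge0 le1] := value_itv theta [tuple of a h ++ b (nseq k false)].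
  apply/eqP; rewrite eq_le le1 leNgt; apply/negP => lt1.
  have := inc_inf _ _ (incomparable_comb hk); apply/eqP; rewrite lt_eqF //.
  set F := fun x : m.-tuple M => _.
  apply: (@le_lt_trans _ _ (F (a h))); last by rewrite /F gt_max lt1 andbT; lra.
  apply: ge_inf; last by exists (a h).
  exists 0 => _ [x _ <-]; rewrite /F le_max.
  by have /andP[->] := value_itv theta [tuple of x ++ b (nseq k false)]; rewrite orbT.
(* The reversed ramp sends the value 1 to 0 and values below 1/2 to 1. *)
apply: (st m l (rescale theta true 0 2^-1)); exists 0, 1; split=> //.
exists M => //; exists a, (fun k => b (nseq k false)) => h k hk; split.
  by rewrite rescale_eq0 ?invr_gt0 // far // subrr normr0.
rewrite rescale_eq1 ?invr_gt0 //.
have := near k h (ltnW hk); set t := value2 _ _ _ => t_lt.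
rewrite (_ : true%:R = 1 :> R) // ler0_norm; lra.
Qed.

End Directions.

(** * The two properties from patterns *)

Section Unstable.
Context (R : realType) (V : vocabulary R) (T : set (sentence V)).
Context (M : metric_structure V) (MT : models M T).
Context (m n : nat) (phi : formula V (m + n)) (b : nat -> n.-tuple M).

Local Notation g := (fun (x : m.-tuple M) k => value2 phi x (b k)).

Lemma shattered_independence c : 0 < c -> c < 2^-1 ->
  (forall N, exists2 ks, size ks = N &
    forall w, size w = N -> realizable g ks w c) ->
  independence_property T.
Proof.
move=> c0 c_half shat.
exists m, n, (rescale phi false c (1 - c)); exists M => // N.
have [ks ksN real] := shat N.
(* Membership corresponds to the letter 0, since the value 0 means truth. *)
pose w (Z : {set 'I_N}) := [seq i \notin Z | i <- enum 'I_N].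
have size_w Z : size (w Z) = N by rewrite size_map size_enum_ord.
have [a Ha] := choice (fun Z => real (w Z) (size_w Z)).
exists a, (fun i => b (nth 0%N ks i)) => Z i.
have nth_w : nth false (w Z) i = (i \notin Z).
  by rewrite (nth_map i) ?size_enum_ord // nth_ord_enum.
have := Ha Z (nth 0%N ks i, i \notin Z); rewrite -{1}nth_w.
rewrite mem_zip_nth ?ksN ?size_w // => /(_ isT) /=.
have cc : c < 1 - c by lra.
case: (i \in Z) => /= near; split=> // _.
  by apply: rescale_eq0; [exact: ltW | exact: cc | exact: ltW].
apply: rescale_eq1 => //.
set t := value2 _ _ _ in near *; have /andP[t0 _] : 0 <= t <= 1 := value_itv _ _.
rewrite (_ : false%:R = 0 :> R) // subr0 ger0_norm //.
move: near; rewrite (_ : true%:R = 1 :> R) // ltr_distl; lra.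
Qed.

(** Each condition of [SOP2] involves finitely many nodes, hence holds in the tree of height [D] for
    all large [D]; the ultrapower joins these trees into an infinite one. *)
Lemma tree_SOP2 (U : set_system nat) (W : seq bool) (u v : R) :
  UltraFilter U -> (forall k : nat, U [set l | (k < l)%N]) ->
  0 < u -> u < v ->
  (forall D, exists z : seq bool -> seq nat,
    [/\ forall mu, (size mu < D)%N -> size (z mu) = size W,
      forall mu, (size mu < D)%N -> exists x, forall nu, prefix nu mu ->
        realizes g x (zip (z nu) W) u &
      forall mu nu, (size mu < D)%N -> (size nu < D)%N ->
        ~~ comparable_words mu nu -> forall x,
        realizes g x (zip (z mu) W) v -> realizes g x (zip (z nu) W) v -> False]) ->
  SOP2 T.
Proof.
move=> UU U_gt u0 uv /choice[z Hz].
have [a0 _] := carrier_nonempty M.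
pose K := size W; pose s (i : 'I_K) := nth false W i.
pose c D mu := join_tuple (fun i : 'I_K => b (nth 0%N (z D mu) i)).
pose theta := pattern_formula phi s u v.
have theta_eq0 D mu x : (size mu < D)%N ->
    realizes g x (zip (z D mu) W) u -> value2 theta x (c D mu) = 0.
  move=> muD xr; rewrite value2_pattern; apply: threshold_eq0 => //.
    exact: ltW.
  have [size_z _ _] := Hz D.
  move=> i; rewrite mxE; apply/ltW.
  apply: (xr (nth 0%N (z D mu) i, nth false W i)).
  by apply: mem_zip_nth; rewrite size_z.
have theta_lt1 D mu x : (size mu < D)%N -> value2 theta x (c D mu) < 1 ->
    realizes g x (zip (z D mu) W) v.
  have [size_z _ _] := Hz D => /size_z zK.
  rewrite value2_pattern => /(threshold_lt1 uv) near p /(nthP (0%N, false))[i].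
  rewrite size_zip zK minnn => iK <-; rewrite nth_zip //.
  by have := near (Ordinal iK); rewrite mxE.
pose N := ultrapower M UU U_gt.
pose B mu := class_tuple UU U_gt (fun D => c D mu).
have theta_itv (x : m.-tuple N) mu : 0 <= value2 theta x (B mu) <= 1.
  exact: value_itv.
exists m, #|{: 'I_K * 'I_n}|, theta; exists N; first exact: ultrapower_models.
exists B; split=> [sigma L|mu nu inc].
  have path D : exists x : m.-tuple M, (L < D)%N ->
      forall k, (k < L)%N -> value2 theta x (c D (mkseq sigma k)) = 0.
    (* If the tree is too low for the branch, a dummy tuple is taken. *)
    case: (ltnP L D) => LD; last by exists [tuple a0 | _ < m].
    have [_ /(_ (mkseq sigma L)) Hpath _] := Hz D.
    have [|x xr] := Hpath; first by rewrite size_mkseq.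
    exists x => _ k kL; apply: theta_eq0; first by rewrite size_mkseq; lia.
    by apply: xr; rewrite prefixE size_mkseq -map_take take_iota (minn_idPl (ltnW kL)).
  have [xs Hxs] := choice path.
  apply: (@inf_eq _ _ _ _ (class_tuple UU U_gt xs)) => [x|].
    exact: bigmax_ge_id.
  apply/eqP; rewrite eq_le bigmax_ge_id andbT; apply: bigmax_le => // k _.
  rewrite (_ : value2 _ _ _ = 0) //; apply: value2_los_eq.
  apply: filterS (U_gt L) => D LD.
  exact: Hxs.
have one (x : m.-tuple N) :
    Num.max (value2 theta x (B mu)) (value2 theta x (B nu)) = 1.
  have [xs ->] := class_tupleK x; set y := class_tuple _ _ _.
  have /andP[_ mu1] := theta_itv y mu; have /andP[_ nu1] := theta_itv y nu.
  (* Either [theta] is 1 at [mu] for [U]-many [D], or it differs from 1 there for [U]-many [D], and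
     then exclusion forces the value 1 at [nu]. *)
  have [Umu|Unmu] := in_ultra_setVsetC
      [set D | value2 theta (xs D) (c D mu) = 1] UU.
    have -> : value2 theta y (B mu) = 1 by exact: value2_los_eq Umu.
    exact/max_idPl.
  suff -> : value2 theta y (B nu) = 1 by exact/max_idPr.
  apply: value2_los_eq.
  apply: filterS2 Unmu (U_gt (maxn (size mu) (size nu))) => D /= /eqP mu_neq1.
  rewrite gtn_max => /andP[muD nuD]; have [_ _ /(_ mu nu muD nuD inc) clash] := Hz D.
  have value1 w : (size w < D)%N -> value2 theta (xs D) (c D w) != 1 ->
      realizes g (xs D) (zip (z D w) W) v.
    move=> wD neq1; apply: theta_lt1 => //; rewrite lt_neqAle neq1.
    by have /andP[] := value_itv theta [tuple of xs D ++ c D w].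
  by apply/eqP/negPn/negP => nu_neq1; apply: (clash (xs D)); exact: value1.
have [x0 _] : [set: m.-tuple N] !=set0.
  by have [x0 _] := carrier_nonempty N; exists [tuple x0 | _ < m].
by apply: (@inf_eq _ _ _ _ x0) => [x|]; rewrite one.
Qed.

End Unstable.

Theorem theorem9p5 (R : realType) (V : vocabulary R) (T : set (sentence V)) :
  metric_theory T -> (~ stable T <-> SOP2 T \/ independence_property T).
Proof.
move=> _; split; last by case; [exact: SOP2_unstable | exact: independence_unstable].
move=> nst; apply: contrapT => nSI; apply: nst => m n phi.
move=> [s [r [s0 sr r1 [M MT [a [b ab]]]]]]; apply: nSI.
pose phi01 := rescale phi false s r.
pose g := fun (x : m.-tuple M) k => value2 phi01 x (b k).
have false0 : false%:R = 0 :> R by [].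
have g_lt h k : (h < k)%N -> g (a h) k = 0.
  move=> /ab[le_s _]; apply: rescale_eq0 => //.
  by rewrite subr0 ger0_norm //; have /andP[] := value_itv phi [tuple of a h ++ b k].
have g_gt h k : (k < h)%N -> g (a h) k = 1.
  move=> /ab[_ le_r]; apply: rescale_eq1 => //.
  by rewrite subr0; apply: le_trans le_r (ler_norm _).
have [U [UU U_gt]] := nonprincipal_ultrafilter.
have [rob|[p [q [u [v [u0 uv rob]]]]]] := robust_dichotomy UU U_gt g_lt g_gt.
  (* Any positive accuracy below 1/2 separates the letters. *)
  right; apply: (@shattered_independence _ _ T M MT _ _ phi01 b 3^-1).
  - by rewrite invr_gt0.
  - by rewrite ltf_pV2 ?posrE // ltr_nat.
  move=> N; apply: (shattered UU) => w.
  by rewrite -[w]blow1; apply: rob; rewrite invr_gt0.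
(* The number of repetitions at which robustness fails becomes the block size. *)
move=> /existsNP[K nrob]; left.
apply: (tree_SOP2 MT UU U_gt u0 uv) => D.
have [z Hz] := pattern_tree UU rob nrob D.
by exists z; exact: Hz.
Qed.
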